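(* Let $\Theta$ be a finite set, $\pi\in\Delta(\Theta)$ a full-support prior, $A\subset\mathbb{R}^\Theta$ a finite nonempty set of actions, and $f_\pi:\mathbb{R}_+^\Theta\to[0,+\infty]$ a convex, lower semicontinuous function with $f_\pi(\mathbf 1)=0$ satisfying the regularity assumptions (superlinearity at infinity, essential strict convexity, nondegeneracy of domain) listed in the context. Consider the information acquisition problem $$\text{(RI)}\qquad \max_{P\in\Delta(A)^\Theta}\ \sum_{\theta\in\Theta}\pi(\theta)\sum_{a\in A}P_\theta(a)a(\theta)-I_f(P,\pi)$$ and the maxmin problem $$\text{(MM)}\qquad \max_{\alpha\in\Delta(A)}\ \min_{\lambda\in\mathbb{R}^\Theta}\ \sum_{a\in A}\alpha(a)f_\pi^\star(a\pi-\lambda)+\sum_{\theta\in\Theta}\lambda(\theta).$$ Then: (i) A stochastic choice rule $P=(P_\theta)_{\theta\in\Theta}\in\Delta(A)^\Theta$ is a solution to (RI) if and only if there exists a saddle point $(\alpha,\lambda)$ of (MM) such that, for all $\theta\in\Theta$ and $a\in A$, $$P_\theta(a)=\alpha(a)\,\nabla_\theta f_\pi^\star(a\pi-\lambda).$$ Moreover, for any such $P$ and $(\alpha,\lambda)$, $\alpha$ is an $f$-mean of $P$ under $\pi$. (ii) The optimization problem (RI) and the maxmin problem (MM) have the same value.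
   Context: $\Delta(X)$ denotes the set of probability distributions on the finite set $X$; $\mathbf 1=(1,\dots,1)$. An action $a\in A\subset\mathbb{R}^\Theta$ is identified with its vector of state-contingent utilities $a(\theta)$. For $a,\pi\in\mathbb{R}^\Theta$, $a\pi=(a(\theta)\pi(\theta))_{\theta\in\Theta}$ is the componentwise product. For a finite set $S$, $P=(P_\theta)_{\theta\in\Theta}\in\Delta(S)^\Theta$ and $\alpha\in\Delta(S)$, the multivariate $f_\pi$-divergence is $$D_{f_\pi}(P\Vert\alpha)=\sum_{s\in S}\alpha(s)\,f_\pi\Big(\Big(\tfrac{P_\theta(s)}{\alpha(s)}\Big)_{\theta\in\Theta}\Big),$$ with the convention that when $\alpha(s)=0$ the summand is $\lim_{t\to+\infty}f_\pi(\mathbf 1+tx)/t$ where $x=(P_\theta(s))_{\theta\in\Theta}$. The $f$-information of $P$ under $\pi$ is $I_f(P,\pi)=\min_{\alpha\in\Delta(S)}D_{f_\pi}(P\Vert\alpha)$, and any minimizer $\alpha$ is called an $f$-mean of $P$ under $\pi$. In the claim $S=A$. Regularity assumptions on $f_\pi$, with $\operatorname{dom}f_\pi=\{x\in\mathbb{R}^\Theta_+: f_\pi(x)<+\infty\}$: (1) superlinearity at infinity: for every $y\in\operatorname{dom}f_\pi$ and every nonzero $x\in\mathbb{R}_+^\Theta$, $\lim_{t\to+\infty}f_\pi(y+tx)/t=+\infty$; (2) essential strict convexity: $f_\pi$ is strictly convex on every convex subset of $\{x\in\mathbb{R}_+^\Theta:\partial f_\pi(x)\neq\varnothing\}$; (3)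 nondegeneracy of domain: $\mathbf 1$ lies in the relative interior of $\operatorname{dom}f_\pi$. The Fenchel conjugate is $f_\pi^\star(x)=\sup_{y\in\mathbb{R}_+^\Theta}\sum_{\theta}x(\theta)y(\theta)-f_\pi(y)$, $x\in\mathbb{R}^\Theta$; under (1)-(2) it is finite and differentiable on $\mathbb{R}^\Theta$, and $\nabla_\theta f_\pi^\star$ is its partial derivative with respect to the $\theta$-th coordinate. A saddle point of (MM), with objective $L(\alpha,\lambda)$, is a pair $(\alpha,\lambda)\in\Delta(A)\times\mathbb{R}^\Theta$ with $L(\beta,\lambda)\le L(\alpha,\lambda)\le L(\alpha,l)$ for all $\beta\in\Delta(A)$, $l\in\mathbb{R}^\Theta$. *)

(* Defs.v *)
From mathcomp Require Import all_boot all_order all_algebra finmap.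
From mathcomp Require Import all_classical all_reals all_analysis.
Set Implicit Arguments.
Unset Strict Implicit.
Unset Printing Implicit Defensive.
Import Order.TTheory GRing.Theory Num.Theory.
Import numFieldNormedType.Exports.
Local Open Scope classical_set_scope.
Local Open Scope ring_scope.

Section optimization.
Context {R : realType} {T : Type}.
Implicit Types (D : set T).
Local Open Scope ereal_scope.

Definition is_argmax D (F : T -> \bar R) (x : T) :=
  D x /\ forall y, D y -> F y <= F x.

Definition is_argmin D (F : T -> \bar R) (x : T) :=
  D x /\ forall y, D y -> F x <= F y.

Definition is_max D (F : T -> \bar R) (v : \bar R) :=
  exists2 x, is_argmax D F x & F x = v.

Definition is_min D (F : T -> \bar R) (v : \bar R) :=
  exists2 x, is_argmin D F x & F x = v.

End optimization.

Section maxmin.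
Context {R : realType} {T U : Type}.
Implicit Types (D : set T) (E : set U).

(* [v = max_(x in D) min_(y in E) F x y], all extrema being attained. *)
Definition is_maxmin D E (F : T -> U -> \bar R) (v : \bar R) :=
  exists2 m : T -> \bar R,
    (forall x, D x -> is_min E (F x) (m x)) & is_max D m v.

Definition saddle_point D E (F : T -> U -> \bar R) (x : T) (y : U) :=
  [/\ D x, E y, (forall x', D x' -> (F x' y <= F x y)%E)
    & (forall y', E y' -> (F x y <= F x y')%E)].

End maxmin.

Section simplex.
Context {R : realType}.

Definition simplex (X : finType) : set (X -> R) :=
  [set p | (forall x, 0 <= p x) /\ \sum_x p x = 1].

Definition kernels (Theta X : finType) : set (Theta -> X -> R) :=
  [set P | forall th, @simplex X (P th)].

End simplex.
Arguments simplex {R} X.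
Arguments kernels {R} Theta X.

(* A function [f : R_+^Theta -> [0, +oo]] is represented by a total function
   on [Theta -> R]; its values outside the nonnegative orthant are irrelevant
   to the notions below (for nonnegative [P] and [alpha] in the divergence). *)
Section convex_analysis.
Context {R : realType} {Theta : finType}.
Implicit Types (f : (Theta -> R) -> \bar R) (D : set (Theta -> R)).

Definition orthant : set (Theta -> R) := [set x | forall th, 0 <= x th].

Definition dot (x y : Theta -> R) : R := \sum_th x th * y th.

Definition dom f : set (Theta -> R) := [set x | orthant x /\ (f x < +oo)%E].

(* The library's [convex_function] is for real-valued functions. Here
   [0 * +oo = 0], which is harmless at the endpoints [t = 0, 1]. *)
Definition convex_fun f := forall (x y : Theta -> R) (t : R),
  orthant x -> orthant y -> 0 <= t <= 1 ->
  (f (t *: x + (1 - t) *: y)%R <= t%:E * f x + (1 - t)%:E * f y)%E.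

(* Euclidean topology on [R^Theta] = pointwise topology, [Theta] being
   finite; semicontinuity is relative to the orthant. *)
Definition lsc_fun f :=
  lower_semicontinuous
    (f : subspace (orthant : set {ptws Theta -> R}) -> \bar R).

Definition subdifferential f (x : Theta -> R) : set (Theta -> R) :=
  [set p | forall y, orthant y ->
     (f x + (dot p (fun th => y th - x th))%:E <= f y)%E].

Definition strictly_convex_on D f := forall (x y : Theta -> R) (t : R),
  D x -> D y -> x <> y -> 0 < t < 1 ->
  (f (t *: x + (1 - t) *: y)%R < t%:E * f x + (1 - t)%:E * f y)%E.

Definition superlinear_at_infinity f := forall y x : Theta -> R,
  dom f y -> orthant x -> x <> 0 ->
  ((t^-1)%:E * f (y + t *: x)%R)%E @[t --> +oo%R] --> +oo%E.

Definition essentially_strictly_convex f := forall D,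
  convex_set D ->
  D `<=` [set x | orthant x /\ subdifferential f x !=set0] ->
  strictly_convex_on D f.

Definition affine_hull D : set (Theta -> R) :=
  [set z | exists (n : nat) (w : 'I_n -> R) (p : 'I_n -> Theta -> R),
     [/\ forall i, D (p i), \sum_i w i = 1 & z = \sum_i w i *: p i]].

(* Interior of [D] in the topology induced on its affine hull. *)
Definition relative_interior D : set (Theta -> R) :=
  [set x | affine_hull D x /\
     within (affine_hull D) (nbhs (x : {ptws Theta -> R})) D].

Definition nondegenerate_domain f := relative_interior (dom f) (fun=> 1).

Definition conjugate f (x : Theta -> R) : \bar R :=
  ereal_sup [set ((dot x y)%:E - f y)%E | y in orthant].

(* Partial derivative in the [th]-th coordinate of an extended-real function
   (meaningful where the function is finite and differentiable). *)
Definition partial (th : Theta) (g : (Theta -> R) -> \bar R)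
    (x : Theta -> R) : R :=
  derive1 (fun t : R => fine (g (fun th' => x th' + t * (th' == th)%:R))) 0.

End convex_analysis.

(* [f] stands for [f_pi], the prior being fixed throughout. *)
Section information.
Context {R : realType} {Theta : finType}.
Variable f : (Theta -> R) -> \bar R.
Local Open Scope ereal_scope.

Definition divergence (S : finType) (P : Theta -> S -> R) (alpha : S -> R) :
    \bar R :=
  \sum_(s : S)
    if alpha s == 0%R then
      lim ((t^-1)%:E * f (fun th => 1 + t * P th s)%R @[t --> +oo%R])
    else (alpha s)%:E * f (fun th => P th s / alpha s)%R.

(* When [f] is a nonnegative, convex, lower semicontinuous function on the
   orthant, vanishing at [1] and superlinear at infinity, this infimum is
   attained, i.e. it is a minimum. *)
Definition f_information (S : finType) (P : Theta -> S -> R) : \bar R :=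
  ereal_inf [set divergence P alpha | alpha in simplex S].

Definition f_mean (S : finType) (P : Theta -> S -> R) (alpha : S -> R) :=
  is_argmin (simplex S) (divergence P) alpha.

Variables (pi : Theta -> R) (A : {fset (Theta -> R)}).

Definition RI_objective (P : Theta -> A -> R) : \bar R :=
  (\sum_th pi th * \sum_(a : A) P th a * val a th)%R%:E - f_information P.

Definition MM_objective (alpha : A -> R) (lambda : Theta -> R) : \bar R :=
  \sum_(a : A) (alpha a)%:E
      * conjugate f (fun th => val a th * pi th - lambda th)%R
  + (\sum_th lambda th)%R%:E.

End information.

(* Main.v *)
(**
Write [g a l] for f^*(a pi - l) + sum l, so that the objective of (MM) is the
average of the [g a] under [alpha]. Splitting the divergence into perspectives
of f and applying Fenchel's inequality to each of them gives
   payoff P - D(P || alpha) <= L(alpha, l)  for all P, alpha, l,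
with equality if and only if P_theta(a) = alpha(a) grad_theta f^*(a pi - l).
Superlinearity makes the supremum defining f^* attained, and essential strict
convexity makes the maximizer unique, so it is the gradient of f^*. Hence a
pair (alpha, l) together with the P given by the gradient formula is optimal
on both sides as soon as l minimizes max_a (g a), alpha is supported on
the maximizing actions and the gradients of the [g a] average to zero under
alpha. Such an l exists because 1 is in the relative interior of dom f, which
makes the [g a] coercive modulo the directions along which they are constant;
such an alpha exists by Gordan's alternative.
*)
Require Import Defs.
From mathcomp Require Import all_boot all_order all_algebra finmap.
From mathcomp Require Import all_classical all_reals all_analysis.
From mathcomp Require Import ring lra.
Set Implicit Arguments.
Unset Strict Implicit.
Unset Printing Implicit Defensive.
Import Order.TTheory GRing.Theory Num.Theory.
Import numFieldNormedType.Exports.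
Local Open Scope classical_set_scope.
Local Open Scope ring_scope.

(** * Lower semicontinuity and compactness *)

(** A filter and a separate target value let one notion cover full neighbourhoods as well as
    neighbourhoods within a subset. *)
Definition lsc_at (R : realType) (T : Type) (F : set_system T)
    (h : T -> \bar R) (v : \bar R) :=
  forall r : R, (r%:E < v)%E -> \forall t \near F, (r%:E < h t)%E.

Section lsc_at.
Context {R : realType} {T : Type} (F : set_system T) {FF : Filter F}.

Lemma lsc_at_cvg (h : T -> R) (v : R) :
  h @ F --> v -> lsc_at F (fun t => (h t)%:E) v%:E.
Proof.
move=> hv r; rewrite lte_fin => rv.
by apply: filterS (@cvgr_gt _ _ _ FF _ _ hv _ rv) => t; rewrite lte_fin.
Qed.

Lemma lsc_atD (h k : T -> \bar R) v w :
  lsc_at F h v -> lsc_at F k w -> lsc_at F (fun t => h t + k t)%E (v + w)%E.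
Proof.
move=> hv kw r rvw.
(* Finite summands share the slack [v + w - r] equally; an infinite one leaves room to lower the
   other. *)
have [a [b [av bw rab]]] : exists a b : R,
    [/\ (a%:E < v)%E, (b%:E < w)%E & r <= a + b].
  case: v w rvw {hv kw} => [v| |] [w| |] //=.
  - rewrite -EFinD lte_fin => rvw.
    exists (v - (v + w - r) / 2), (w - (v + w - r) / 2).
    by rewrite !lte_fin; split=> //; lra.
  - by move=> _; exists (v - 1), (r - v + 1); rewrite ltry lte_fin; split=> //;
    lra.
  - by move=> _; exists (r - w + 1), (w - 1); rewrite ltry lte_fin; split=> //;
    lra.
  - by move=> _; exists r, 0; rewrite !ltry addr0.
apply: filterS (filterI (hv a av) (kw b bw)) => t [ha kb].
by rewrite (@le_lt_trans _ _ (a%:E + b%:E)%E) ?lteD// -EFinD lee_fin.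
Qed.

Lemma lsc_atZ (h : T -> R) (v c : R) : 0 <= c ->
  lsc_at F (fun t => (h t)%:E) v%:E ->
  lsc_at F (fun t => (c * h t)%:E) (c * v)%:E.
Proof.
move=> c0 hv r; have [->|cn0] := eqVneq c 0.
  by rewrite mul0r => r0; apply: nearW => t; rewrite mul0r.
have cp : 0 < c by rewrite lt_neqAle eq_sym cn0.
rewrite lte_fin -ltr_pdivrMl// -lte_fin => /hv.
by apply: filterS => t; rewrite !lte_fin ltr_pdivrMl.
Qed.

Lemma lsc_at_sum (I : Type) (s : seq I) (h : I -> T -> \bar R)
    (v : I -> \bar R) : (forall i, lsc_at F (h i) (v i)) ->
  lsc_at F (fun t => \sum_(i <- s) h i t)%E (\sum_(i <- s) v i)%E.
Proof.
move=> hv; elim: s => [|i s IH].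
  rewrite big_nil => r r0; apply: nearW => t.
  by rewrite big_nil.
rewrite big_cons => r rv.
by apply: filterS (lsc_atD (hv i) IH rv) => t; rewrite big_cons.
Qed.

End lsc_at.

Lemma lte_between (R : realType) (x y : \bar R) :
  (x < y)%E -> exists r : R, (x < r%:E < y)%E.
Proof.
case: x y => [x| |] [y| |] //=.
- by rewrite lte_fin => xy; exists ((x + y) / 2); rewrite !lte_fin; lra.
- by move=> _; exists (x + 1); rewrite ltry lte_fin; lra.
- by move=> _; exists (y - 1); rewrite ltNyr lte_fin; lra.
- by move=> _; exists 0; rewrite ltry ltNyr.
Qed.

(** The strict sublevel sets at levels above the infimum form a filter base. At a cluster point a
    value above the infimum would, by semicontinuity, push some sublevel set away from that
    point. *)
Lemma compact_lsc_argmin (R : realType) (T : topologicalType) (K : set T)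
    (h : T -> \bar R) : compact K -> K !=set0 ->
  (forall x, K x -> lsc_at (within K (nbhs x)) h (h x)) ->
  exists x, is_argmin K h x.
Proof.
move=> cK [x0 Kx0] lsch; set m := ereal_inf (h @` K).
have mle y : K y -> (m <= h y)%E by move=> Ky; apply: ereal_inf_lbound;
  exists y.
have [mlt|] := ltP m +oo%E; last first.
  rewrite leye_eq => /eqP my; exists x0; split=> // y /mle.
  by rewrite my leye_eq => /eqP ->; rewrite leey.
pose D := [set r : R | (m < r%:E)%E].
pose B (r : R) := [set x | K x /\ (h x < r%:E)%E].
have BK : filter_from D B K.
  by have [r /andP[mr _]] := lte_between mlt; exists r => // x [].
have FF : ProperFilter (filter_from D B).
  apply: filter_from_proper; last first.
    by move=> r /ereal_inf_lt [_ [y Ky <-] hyr]; exists y.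
  apply: filter_from_filter; first by case: BK => r Dr _; exists r.
  move=> i j Di Dj; exists (Num.min i j); first by case: (leP i j).
  by move=> x [Kx]; rewrite EFin_min lt_min => /andP[? ?].
have [p [Kp clp]] := cK _ FF BK.
exists p; split=> // y /mle; apply: le_trans; rewrite leNgt; apply/negP.
move=> /lte_between [r /andP[mr rhp]].
have Br : filter_from D B (B r) by exists r.
have [q [[Kq hq] /(_ Kq)/ltW]] := clp _ _ Br (lsch _ Kp _ rhp).
by rewrite leNgt hq.
Qed.

Section pointwise_topology.
Context {R : realType} {I : finType}.

Global Instance ptws_nbhs_filter (x : {ptws I -> R}) : ProperFilter (nbhs x).
Proof. exact: (@nbhs_pfilter {ptws I -> R}). Qed.

Lemma cvg_coord {T : Type} (F : set_system T) {FF : Filter F}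
    (g : T -> I -> R) (x : I -> R) :
  (forall i, g t i @[t --> F] --> x i) ->
  g @ F --> (x : {ptws I -> R}).
Proof.
move=> gx; apply/cvg_sup => i A [_ [[C oC <-] Cx] CA].
apply: (filterS CA); apply: (gx i C).
by apply: open_nbhs_nbhs; split.
Qed.

Lemma cvg_eval (x : {ptws I -> R}) (i : I) :
  (fun y : {ptws I -> R} => y i) @ nbhs x --> x i.
Proof. exact: (@proj_continuous I (fun=> R) i x). Qed.

Lemma cvg_sumr {T : Type} (F : set_system T) {FF : Filter F}
    (g : I -> T -> R) (v : I -> R) :
  (forall i, g i t @[t --> F] --> v i) ->
  \sum_i g i t @[t --> F] --> \sum_i v i.
Proof. by move=> gv; apply: cvg_big => //; exact: add_continuous. Qed.

Lemma cvg_dot {T : Type} (F : set_system T) {FF : Filter F}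
    (g h : T -> I -> R) (x y : I -> R) :
  (forall i, g t i @[t --> F] --> x i) ->
  (forall i, h t i @[t --> F] --> y i) ->
  dot (g t) (h t) @[t --> F] --> dot x y.
Proof.
move=> gx hy; rewrite /dot; apply: cvg_sumr => i.
by apply: cvgM.
Qed.

Lemma compact_box (a b : R) :
  compact [set y : {ptws I -> R} | forall i, `[a, b]%classic (y i)].
Proof.
apply: (@tychonoff I (fun=> R : topologicalType) (fun=> `[a, b]%classic)) => i.
exact: segment_compact.
Qed.

Lemma compact_simplex : compact (simplex I : set {ptws I -> R}).
Proof.
have -> : (simplex I : set {ptws I -> R}) =
    [set y : {ptws I -> R} | forall i, `[0, 1]%classic (y i)] `&`
    [set y : {ptws I -> R} | \sum_i y i = 1].
  apply/seteqP; split=> y /=.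
    move=> [y0 y1]; split=> // i; rewrite in_itv/= y0 -y1.
    by rewrite (bigD1 i)//= lerDl sumr_ge0.
  by move=> [y01 y1]; split=> // i; have := y01 i; rewrite in_itv/= => /andP[].
apply: compact_closedI; first exact: compact_box.
apply: (@closed_comp {ptws I -> R} R (fun y => \sum_i y i) [set 1]).
  move=> y _; exact: (@cvg_sumr _ (nbhs y) _ (fun i (z : {ptws I -> R}) => z i)
    y (@cvg_eval y)).
exact: closed_eq.
Qed.

End pointwise_topology.

(** * Fenchel conjugate of a superlinear function *)

Section dot_product.
Context {R : realType} {I : finType}.
Implicit Types x y z d : I -> R.

Lemma dotC x y : dot x y = dot y x.
Proof. by apply: eq_bigr => i _; rewrite mulrC. Qed.

Lemma dotDl x y z : dot (x + y) z = dot x z + dot y z.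
Proof. by rewrite /dot -big_split; apply: eq_bigr => i _ /=;
  rewrite mulrDl. Qed.

Lemma dotZl (t : R) x y : dot (t *: x) y = t * dot x y.
Proof. by rewrite /dot big_distrr; apply: eq_bigr => i _ /=; rewrite mulrA. Qed.

Lemma dotNl x y : dot (- x) y = - dot x y.
Proof. by rewrite -scaleN1r dotZl mulN1r. Qed.

Lemma dotBl x y z : dot (x - y) z = dot x z - dot y z.
Proof. by rewrite dotDl dotNl. Qed.

Lemma dotDr x y z : dot x (y + z) = dot x y + dot x z.
Proof. by rewrite dotC dotDl !(dotC x). Qed.

Lemma dotZr (t : R) x y : dot x (t *: y) = t * dot x y.
Proof. by rewrite dotC dotZl dotC. Qed.

Lemma dotBr x y z : dot x (y - z) = dot x y - dot x z.
Proof. by rewrite dotC dotBl !(dotC x). Qed.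

Lemma dot1r x : dot x (fun=> 1) = \sum_i x i.
Proof. by apply: eq_bigr => i _; rewrite mulr1. Qed.

Lemma dot0r x : dot x 0 = 0.
Proof. by rewrite /dot big1// => i _; rewrite mulr0. Qed.

End dot_product.

Section fenchel_equality.
Context {R : realType} {Theta : finType} (f : (Theta -> R) -> \bar R).

(* [fine] loses nothing: [conjugate f] is finite by superlinearity. *)
Definition conjR (x : Theta -> R) : R := fine (conjugate f x).

(** Equality in Fenchel's inequality: [y] attains the supremum defining [conjugate f x]. *)
Definition fenchel_tight (x y : Theta -> R) :=
  orthant y /\ f y = (dot x y - conjR x)%:E.

(* The unique maximizer defining [conjugate f x]; it is the gradient of the
   conjugate at [x] (see [partial_conjugate]). *)
Definition grad (x : Theta -> R) : Theta -> R :=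
  xget (fun=> 0) (fenchel_tight x).

Record regular : Prop := Regular {
  regular_ge0 : forall x, orthant x -> (0 <= f x)%E;
  regular_convex : convex_fun f;
  regular_lsc : lsc_fun f;
  regular1 : f (fun=> 1) = 0%E;
  regular_superlinear : superlinear_at_infinity f;
  regular_strict : essentially_strictly_convex f }.

End fenchel_equality.

Section regular_function.
Context {R : realType} {Theta : finType} (f : (Theta -> R) -> \bar R).
Hypothesis f_regular : regular f.
Implicit Types x y z d : Theta -> R.

Let f_ge0 := regular_ge0 f_regular.
Let f_convex := regular_convex f_regular.
Let f_lsc := regular_lsc f_regular.
Let f1 := regular1 f_regular.
Let f_superlinear := regular_superlinear f_regular.
Let f_strict := regular_strict f_regular.

Let orthant1 : orthant (fun=> 1 : R) (Theta := Theta).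
Proof. by move=> i; exact: ler01. Qed.

(** At a point of the orthant, subspace neighbourhoods are traces of ambient ones; this moves
    relative semicontinuity to the ambient topology. *)
Lemma lsc_fun_near x (r : R) : orthant x -> (r%:E < f x)%E ->
  \forall z \near (x : {ptws Theta -> R}), orthant z -> (r%:E < f z)%E.
Proof.
move=> ox rx; have [V nV rV] := f_lsc rx.
have : \forall z \near (x : {ptws Theta -> R}), orthant z -> V z.
  exact: (eq_ind_r (fun F : set_system _ => F V) nV
    (@nbhs_subspace_in {ptws Theta -> R} orthant x ox)).
apply: (@filterS {ptws Theta -> R} _ (@nbhs_filter {ptws Theta -> R} x)).
by move=> z Vz oz; apply: rV; exact: Vz.
Qed.

(** Superlinearity is assumed ray by ray; compactness of the simplex of directions makes it
    uniform. *)
Lemma superlinear_growth (C : R) : exists2 M : R, 0 < M &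
  forall y, orthant y -> M < \sum_th y th -> ((C * \sum_th y th)%:E < f y)%E.
Proof.
(* Points of mass [1 / s] are written [s^-1 *: d] with [d] in the simplex, so large mass means small
   [s]. *)
pose P (s : R) (d : {ptws Theta -> R}) :=
  simplex Theta d -> ((C / s)%:E < f (s^-1 *: (d : Theta -> R)))%E.
have : \forall s \near 0^'+, simplex Theta `<=` P s.
  apply: (iffLR (@compact_near_coveringP _ _) compact_simplex) => d Sd.
  have [d0 d1] := Sd.
  have dn0 : (d : Theta -> R) <> 0.
    move=> d00; have : (1 : R) = 0 by rewrite -d1 d00 big1.
    by move/eqP; rewrite oner_eq0.
  have dom1 : dom f (fun=> 1) by split; rewrite ?f1.
  have [t t0 tC] : exists2 t : R, 0 < t &
      ((C * t)%:E < f ((fun=> 1%R) + t *: (d : Theta -> R))%R)%E.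
    have /cvgeyPgt/(_ C) Ct := f_superlinear dom1 d0 dn0.
    have [t [t0 tC]] := filter_ex (filterI (nbhs_pinfty_gt (num_real 0)) Ct).
    by exists t => //; rewrite mulrC EFinM -lte_pdivlMl.
  set z := (fun=> 1%R) + t *: (d : Theta -> R) in tC.
  have oz : orthant z.
    by move=> i; rewrite /z /= !fctE addr_ge0// mulr_ge0// ltW.
  (* [g p] lies on the segment from the point 1 to [p.2^-1 *: p.1] and tends to [z]. Semicontinuity
     bounds [f (g p)] from below, and convexity carries the bound to the far endpoint because [f]
     vanishes at 1. *)
  pose g (p : {ptws Theta -> R} * R) : Theta -> R :=
    (t * p.2) *: (p.2^-1 *: (p.1 : Theta -> R)) + (1 - t * p.2) *: (fun=> 1).
  set F := filter_prod (nbhs d) (0 : R)^'+.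
  have FF : Filter F by exact: filter_prod_filter.
  have cvgp : p.2 @[p --> F] --> (0 : R).
    by apply: cvg_trans cvg_snd _; apply: cvg_within.
  have p2gt0 : \forall p \near F, 0 < p.2.
    exact: (@cvg_snd _ _ (nbhs d) (0 : R)^'+ _ [set s : R | 0 < s]
      (nbhs_right_gt 0)).
  have gz : g p @[p --> F] -->
      (z : {ptws Theta -> R}).
    apply: (@cvg_coord _ _ _ F FF g z) => i.
    have : t * p.1 i + (1 - t * p.2)
        @[p --> F] --> t * d i + (1 - t * 0).
      apply: cvgD.
        apply: cvgM; first exact: cvg_cst.
        move=> B nB; exact: (@cvg_fst _ _ (nbhs d) (0 : R)^'+ _ _ (@cvg_eval _
          _ d i B nB)).
      by apply: cvgB; [exact: cvg_cst|apply: cvgM;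
        [exact: cvg_cst|exact: cvgp]].
    rewrite mulr0 subr0 addrC => h.
    rewrite /z /= !fctE; apply: cvg_trans h; apply: near_eq_cvg.
    apply: filterS p2gt0 => p p0; rewrite /g /= !fctE.
    rewrite /GRing.scale/= mulr1 [in RHS]mulrA -[in RHS](mulrA t).
    by rewrite mulfV ?mulr1// gt_eqF.
  have ts1 : \forall p \near F, t * p.2 < 1.
    have : t * p.2 @[p --> F] --> t * 0.
      by apply: cvgM; [exact: cvg_cst|exact: cvgp].
    by rewrite mulr0 => h; exact: (@cvgr_lt _ _ F FF _ _ h _ ltr01).
  have fz : \forall p \near F, orthant (g p) -> ((C * t)%:E < f (g p))%E.
    exact: (gz _ (lsc_fun_near oz tC)).
  apply: (@filterS3 _ F FF _ _ _ _ _ p2gt0 ts1 fz) => p p0 tp1 fgp [p10 p11].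
  have og : orthant (g p).
    move=> i; rewrite /g /= !fctE /GRing.scale/= mulr1 addr_ge0//.
      by rewrite !mulr_ge0// ?invr_ge0// ltW.
    by rewrite subr_ge0 ltW.
  move: (fgp og) => /lt_le_trans/(_ (f_convex _ _ _)).
  rewrite f1 mule0 adde0 => Ctf.
  have tp0 : 0 < t * p.2 by rewrite mulr_gt0.
  rewrite -(@lte_pmul2l _ (t * p.2)%:E)// -EFinM.
  have -> : t * p.2 * (C / p.2) = C * t.
    by rewrite mulrC mulrA (mulrC _ t) mulrCA mulrA divfK ?gt_eqF// mulrC.
  apply: Ctf => //.
    by move=> i; rewrite !fctE /GRing.scale/= mulr_ge0// invr_ge0 ltW.
  by rewrite ltW//= ltW.
move=> [e /= e0 eP]; exists e^-1; first by rewrite invr_gt0.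
move=> y oy; set S := \sum_th y th => eS.
have S0 : 0 < S by rewrite (lt_trans _ eS)// invr_gt0.
have Sy : simplex Theta (S^-1 *: y).
  split; first by move=> i; rewrite !fctE /GRing.scale/= mulr_ge0// invr_ge0
    ltW.
  by rewrite -[LHS]/(\sum_th S^-1 * y th) -mulr_sumr mulVf// lt0r_neq0.
have SV0 : 0 < S^-1 by rewrite invr_gt0.
have SVe : S^-1 < e by rewrite invf_plt.
have := eP S^-1; rewrite /= sub0r normrN gtr0_norm// => /(_ SVe SV0 _ Sy Sy).
by rewrite invrK scalerA divff ?lt0r_neq0// scale1r.
Qed.

(** The value at the point 1 is at least [- |N| n], with [n] the cardinality of [Theta]; growth of
    slope [2 |N| + 1] pushes the value at any [y] of large mass below that, uniformly in [x]. *)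
Lemma fenchel_value_bound (N : R) : exists2 M : R, 1 <= M &
  forall x, (forall th, `|x th| <= N) -> forall y, orthant y ->
    M < \sum_th y th -> ((dot x y)%:E - f y < (dot x (fun=> 1%R))%:E)%E.
Proof.
have [M M0 MC] := superlinear_growth (2 * `|N| + 1).
have [n [n0 nE]] : exists n : R, 0 <= n /\ n = #|Theta|%:R by exists
  #|Theta|%:R.
exists (1 + M + n) => [|x xN y oy];
  first by rewrite -addrA lerDl addr_ge0// ltW.
set S := \sum_th y th => MS.
have S0 : 0 <= S by apply: sumr_ge0.
have dxy : dot x y <= `|N| * S.
  rewrite /S mulr_sumr; apply: ler_sum => i _; apply: ler_wpM2r => //.
  by rewrite (le_trans (ler_norm _))// (le_trans (xN i))// ler_norm.
have dx1 : - (`|N| * n) <= dot x (fun=> 1).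
  rewrite dot1r nE mulr_natr -sumr_const -sumrN; apply: ler_sum => i _.
  by rewrite lerNl (le_trans (ler_norm _))// normrN (le_trans (xN i))//
    ler_norm.
have NS : `|N| * n <= `|N| * S by apply: ler_wpM2l => //; lra.
have : (((2 * `|N| + 1) * S)%:E < f y)%E.
  by apply: MC => //; rewrite -/S; lra.
have := f_ge0 oy; case: (f y) => [v _||]//=.
- by rewrite -EFinB !lte_fin; lra.
- by move=> _ _; rewrite addeNy ltNyr.
Qed.
(** Outside the box [[0, M]^Theta] every competitor loses to the point 1, so the lower
    semicontinuous function [f y - dot x y] need only be minimized over this compact box. *)
Lemma conjugate_attained x :
  exists y, is_argmax orthant (fun z => (dot x z)%:E - f z)%E y.
Proof.
have [M M1 Mx] := fenchel_value_bound (\sum_th `|x th|).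
have xN th : `|x th| <= \sum_th `|x th|.
  by rewrite (bigD1 th)//= lerDl sumr_ge0.
pose K := [set y : {ptws Theta -> R} | forall th, `[0, M]%classic (y th)].
have K1 : K (fun=> 1) by move=> th /=; rewrite in_itv/= ler01.
have oK y : K y -> orthant y.
  by move=> Ky th; have := Ky th; rewrite /= in_itv/= => /andP[].
pose h (y : {ptws Theta -> R}) := (f y + (- dot x y)%:E)%E.
have lsch (y : {ptws Theta -> R}) : K y -> lsc_at (within K (nbhs y)) h (h y).
  move=> Ky; apply: lsc_atD.
    move=> r /(lsc_fun_near (oK _ Ky)); apply: filterS => z + Kz.
    by apply; exact: oK.
  apply: lsc_at_cvg; apply: cvg_within_filter; apply: cvgN.
  by apply: (@cvg_dot _ _ _ _ _ (fun=> x)) => th;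
    [exact: cvg_cst|exact: cvg_eval].
have [y [Ky hy]] :=
  @compact_lsc_argmin R {ptws Theta -> R} K h (@compact_box _ _ 0 M)
    (ex_intro _ (fun=> 1) K1) lsch.
have hE z : orthant z -> ((dot x z)%:E - f z = - h z)%E.
  by move=> oz; rewrite /h oppeD ?fin_num_adde_defl// EFinN oppeK addeC.
exists y; split; first exact: oK.
move=> z oz; rewrite (hE y (oK _ Ky)).
have [Kz|nKz] := pselect (K z); first by rewrite hE// leeN2; exact: hy.
have : M < \sum_th z th.
  rewrite ltNge; apply/negP => zM; apply: nKz => th /=; rewrite in_itv/= oz /=.
  by apply: le_trans zM; rewrite (bigD1 th)//= lerDl sumr_ge0.
move=> /(Mx x xN z oz)/ltW/le_trans; apply.
by rewrite leeNr (le_trans (hy _ K1))// /h f1 add0e.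
Qed.

Lemma conjR_attained x :
  exists y, conjugate f x = (conjR f x)%:E /\ fenchel_tight f x y.
Proof.
have [y [oy hy]] := conjugate_attained x; exists y.
have E : conjugate f x = ((dot x y)%:E - f y)%E.
  apply/eqP; rewrite eq_le; apply/andP; split.
    by apply: ge_ereal_sup => _ [z oz <-]; exact: hy.
  by apply: ereal_sup_ubound; exists y.
(* The value at [y] dominates the finite value at the point 1, which excludes [f y = +oo]. *)
have ffin : f y \is a fin_num.
  have := hy _ orthant1; have := f_ge0 oy; rewrite f1 sube0.
  by case: (f y) => //=.
rewrite /fenchel_tight /conjR E -(fineK ffin) -EFinB /=; split=> //; split=> //.
by congr (_%:E); lra.
Qed.

Lemma conjRE x : conjugate f x = (conjR f x)%:E.
Proof. by have [y []] := conjR_attained x. Qed.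

Lemma fenchel_ineq x y : orthant y -> ((dot x y - conjR f x)%:E <= f y)%E.
Proof.
move=> oy; have : ((dot x y)%:E - f y <= conjugate f x)%E.
  by apply: ereal_sup_ubound; exists y.
rewrite conjRE; have := f_ge0 oy; case: (f y) => [v||]//= _;
  last by rewrite leey.
by rewrite -EFinB !lee_fin; lra.
Qed.

(** Tight points form a convex set on which [f] is affine and [x] is a subgradient. Essential strict
    convexity applies to this set, and the midpoint of two distinct tight points would violate
    Fenchel's inequality. *)
Lemma fenchel_tight_unique x y z :
  fenchel_tight f x y -> fenchel_tight f x z -> y = z.
Proof.
have fcomb (a b : Theta -> R) (t : R) :
    fenchel_tight f x a -> fenchel_tight f x b ->
    (t%:E * f a + (1 - t)%:E * f b =
    (dot x (t *: a + (1 - t) *: b) - conjR f x)%:E)%E.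
  move=> [_ ->] [_ ->]; rewrite -!EFinM -EFinD dotDr !dotZr.
  by congr (_%:E); ring.
have ocomb (a b : Theta -> R) (t : R) : orthant a -> orthant b -> 0 <= t <= 1 ->
    orthant (t *: a + (1 - t) *: b).
  by move=> oa ob t01 i; rewrite !fctE addr_ge0// mulr_ge0//; lra.
move=> oy oz; apply: contrapT => yz.
have half01 : 0 < (2^-1 : R) < 1 by lra.
have : strictly_convex_on (fenchel_tight f x) f.
  apply: f_strict.
    move=> a b t /set_mem oa /set_mem ob; apply/mem_set.
    have t01 : 0 <= (t%:num : R) <= 1 by rewrite ge0 le1.
    have oab := ocomb a b t%:num oa.1 ob.1 t01.
    change (fenchel_tight f x
      (t%:num *: (a : Theta -> R) + (1 - t%:num) *: (b : Theta -> R))).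
    split=> //; apply/eqP; rewrite eq_le fenchel_ineq// andbT.
    by rewrite -fcomb//; apply: f_convex => //; [exact: oa.1|exact: ob.1].
  move=> a [oa fa]; split=> //; exists x => b ob.
  apply: le_trans (fenchel_ineq x ob); rewrite fa -EFinD lee_fin.
  by rewrite (_ : (fun th => b th - a th) = b - a)// dotBr; lra.
move=> /(_ _ _ _ oy oz yz half01); rewrite fcomb// ltNge.
by rewrite fenchel_ineq//; apply: ocomb; [exact: oy.1|exact: oz.1|lra].
Qed.

Lemma fenchel_tight_grad x : fenchel_tight f x (grad f x).
Proof. by have [y [_ oy]] := conjR_attained x;
  apply: (@xgetPex _ _ (fenchel_tight f x)); exists y. Qed.

Lemma fenchel_tight_gradE x y : fenchel_tight f x y -> y = grad f x.
Proof. by move=> /fenchel_tight_unique; apply; exact: fenchel_tight_grad. Qed.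

Lemma conjR_subgradient x d : conjR f x + dot d (grad f x) <= conjR f (x + d).
Proof.
have [og fg] := fenchel_tight_grad x.
by have := fenchel_ineq (x + d) og; rewrite fg lee_fin dotDl; lra.
Qed.
End regular_function.

(** * Differentiability of the conjugate *)

Section conjugate_smoothness.
Context {R : realType} {Theta : finType} (f : (Theta -> R) -> \bar R).
Hypothesis f_regular : regular f.
Implicit Types x y z d : Theta -> R.

Lemma grad_orthant x : orthant (grad f x).
Proof. by case: (fenchel_tight_grad f_regular x). Qed.

Lemma f_grad x : f (grad f x) = (dot x (grad f x) - conjR f x)%:E.
Proof. by case: (fenchel_tight_grad f_regular x). Qed.

Lemma fenchel_lt x y : orthant y -> y <> grad f x ->
  ((dot x y - conjR f x)%:E < f y)%E.
Proof.
move=> oy yx; rewrite lt_neqAle fenchel_ineq// andbT; apply/eqP => E.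
by apply: yx; apply: (fenchel_tight_gradE f_regular); split.
Qed.

(** The subgradient inequality gives a continuous affine minorant touching at [x]. *)
Lemma conjR_lsc x : lsc_at (nbhs (x : {ptws Theta -> R}))
  (fun y => (conjR f y)%:E) (conjR f x)%:E.
Proof.
have h : conjR f x + dot ((y : Theta -> R) - x) (grad f x)
    @[y --> (x : {ptws Theta -> R})] --> conjR f x + dot (x - x) (grad f x).
  apply: cvgD; first exact: cvg_cst.
  apply: (@cvg_dot _ _ _ _ _ _ (fun=> grad f x)) => i; last exact: cvg_cst.
  by apply: cvgB; [exact: cvg_eval|exact: cvg_cst].
rewrite subrr dotC dot0r addr0 in h.
move=> r /(lsc_at_cvg h); apply: filterS => y; rewrite !lte_fin => /lt_le_trans.
by apply; have := conjR_subgradient f_regular x ((y : Theta -> R) - x);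
  rewrite [x + _]addrC subrK.
Qed.

(** Every gradient lies in [dom f], so the subgradient inequalities at [x] and at [x + d] involve
    the same number and give the two bounds. *)
Lemma conjR_orthogonal x d : (forall y, dom f y -> dot d y = \sum_th d th) ->
  conjR f (x + d) = conjR f x + \sum_th d th.
Proof.
move=> dE; have dg z : dot d (grad f z) = \sum_th d th.
  by apply: dE; split; [exact: grad_orthant|rewrite f_grad ltry].
apply/eqP; rewrite eq_le; apply/andP; split; last first.
  by rewrite -(dg x); exact: conjR_subgradient.
have := conjR_subgradient f_regular (x + d) (- d).
by rewrite addrK dotNl dg lerBlDr.
Qed.

(** A maximizer cannot lose to the point 1, so [fenchel_value_bound] caps its total mass. *)
Lemma grad_bounded (N : R) : exists M : R, forall x,
  (forall th, `|x th| <= N) -> forall th, 0 <= grad f x th <= M.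
Proof.
have [M M1 MN] := fenchel_value_bound f_regular N; exists M => x xN th.
have og := grad_orthant x; rewrite og /=.
suff : \sum_th grad f x th <= M.
  by apply: le_trans; rewrite (bigD1 th)//= lerDl sumr_ge0.
rewrite leNgt; apply/negP => /(MN x xN _ og).
rewrite f_grad -EFinB lte_fin.
have := fenchel_ineq f_regular x (fun=> ler01).
by rewrite regular1// lee_fin; lra.
Qed.

(* By compactness: any cluster point of [grad f (x + t *: d)] as [t] tends to
   [0] attains equality in Fenchel's inequality at [x], hence is [grad f x]. *)
Lemma grad_continuous_along x d :
  dot d (grad f (x + t *: d)) @[t --> (0 : R)] --> dot d (grad f x).
Proof.
apply/cvgrPdist_lt => e e0.
(* This sum bounds every coordinate of [x + t *: d] when [|t| < 1]. *)
have [M gM] := grad_bounded (\sum_th (`|x th| + `|d th|)).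
pose K := [set y : {ptws Theta -> R} | forall th, `[0, M]%classic (y th)].
pose P (t : R) (y : {ptws Theta -> R}) :=
  fenchel_tight f (x + t *: d) y -> `|dot d (grad f x) - dot d y| < e.
have KP : \forall t \near (0 : R), K `<=` P t.
  apply: (iffLR (@compact_near_coveringP _ K) (@compact_box _ _ 0 M) R
    (nbhs (0 : R)) P _) => y Ky.
  set F := filter_prod (nbhs y) (nbhs (0 : R)).
  have FF : Filter F by exact: filter_prod_filter.
  have cvgy i : p.1 i @[p --> F] --> y i.
    by move=> B nB; exact: (@cvg_fst _ _ (nbhs y) (nbhs (0 : R)) _ _ (@cvg_eval
      _ _ y i B nB)).
  have cvgt : p.2 @[p --> F] --> (0 : R) by exact: cvg_snd.
  have [dy|dy] := ltP `|dot d (grad f x) - dot d y| e.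
    have : `|dot d (grad f x) - dot d (p.1 : Theta -> R)| @[p --> F] -->
        `|dot d (grad f x) - dot d y|.
      apply: cvg_norm; apply: cvgB; first exact: cvg_cst.
      by apply: (@cvg_dot _ _ _ _ _ (fun=> d)) => i;
        [exact: cvg_cst|exact: cvgy].
    by move=> /cvgr_lt/(_ _ dy); apply: filterS => p ? ?.
  have oy : orthant y by move=> i; have := Ky i; rewrite /= in_itv/= => /andP[].
  have yx : (y : Theta -> R) <> grad f x.
    by move=> E; move: dy; rewrite E subrr normr0 leNgt e0.
  (* Strictness at [y] leaves room for [c]. Near [y] semicontinuity keeps [f] above [c], while
     tightness at [x + t *: d] together with the subgradient inequality at [x] would keep it below
     [c] for small [t]. *)
  have [c /andP[c1 c2]] := lte_between (fenchel_lt oy yx).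
  have fc : \forall p \near F, orthant p.1 -> (c%:E < f p.1)%E.
    exact: (@cvg_fst _ _ (nbhs y) (nbhs (0 : R)) _ _ (lsc_fun_near f_regular oy
      c2)).
  have : dot x (p.1 : Theta -> R) - conjR f x +
      p.2 * (dot d (p.1 : Theta -> R) - dot d (grad f x)) @[p --> F] -->
      dot x y - conjR f x + 0 * (dot d y - dot d (grad f x)).
    apply: cvgD.
      apply: cvgB; last exact: cvg_cst.
      by apply: (@cvg_dot _ _ _ _ _ (fun=> x)) => i;
        [exact: cvg_cst|exact: cvgy].
    apply: cvgM; first exact: cvgt.
    apply: cvgB; last exact: cvg_cst.
    by apply: (@cvg_dot _ _ _ _ _ (fun=> d)) => i; [exact: cvg_cst|exact: cvgy].
  rewrite mul0r addr0 => /cvgr_lt/(_ c).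
  rewrite -lte_fin => /(_ c1) cp.
  apply: filterS2 fc cp => p fp cp [op Ep]; exfalso.
  have := fp op; rewrite Ep lte_fin dotDl dotZl.
  have := conjR_subgradient f_regular x (p.2 *: d); rewrite dotZl.
  by move: cp; lra.
have xt : \forall t \near (0 : R), `|t| < 1.
  by exists 1 => //= t; rewrite /= sub0r normrN.
apply: filterS2 KP xt => t KP t1; apply: KP; last exact: fenchel_tight_grad.
move=> i /=; rewrite in_itv/=; apply: gM => j.
rewrite !fctE (le_trans (ler_normD _ _))// normrM.
apply: (@le_trans _ _ (`|x j| + `|d j|)).
  by rewrite lerD2l ler_piMl// ltW.
by rewrite (bigD1 j)//= lerDl sumr_ge0// => k _; rewrite addr_ge0.
Qed.

(** The subgradient inequalities at [x] and at [x + h *: d] trap the difference quotient between the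
    slopes at these points, and the slope is continuous along [d]. *)
Lemma conjR_derive x d :
  h^-1 * (conjR f (x + h *: d) - conjR f x) @[h --> (0 : R)^'] -->
  dot d (grad f x).
Proof.
apply/cvgrPdist_lt => e e0.
have /cvgrPdist_lt/(_ e e0) := @grad_continuous_along x d.
rewrite !near_withinE; apply: filterS => h + h0.
have h1 := conjR_subgradient f_regular x (h *: d).
have h2 := conjR_subgradient f_regular (x + h *: d) (- (h *: d)).
rewrite addrK dotNl dotZl in h2; rewrite dotZl in h1.
set L := dot d (grad f x) in h1 *.
set L' := dot d (grad f (x + h *: d)) in h2 *.
have [q qE] : exists q, conjR f (x + h *: d) - conjR f x = h * q.
  by exists (h^-1 * (conjR f (x + h *: d) - conjR f x)); rewrite mulVKf.
rewrite qE mulKf//; rewrite !ltr_norml => /andP[a b].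
have hq1 : h * L <= h * q by lra.
have hq2 : h * q <= h * L' by lra.
have [hp|hn|h00] := ltgtP h 0; last by rewrite h00 eqxx in h0.
- rewrite ler_nM2l// in hq1; rewrite ler_nM2l// in hq2; lra.
- rewrite ler_pM2l// in hq1; rewrite ler_pM2l// in hq2; lra.
Qed.

Lemma partial_conjugate th x : partial th (conjugate f) x = grad f x th.
Proof.
pose d (th' : Theta) : R := (th' == th)%:R.
have dE y : dot d y = y th.
  rewrite /dot (bigD1 th)//= /d eqxx mul1r big1 ?addr0// => i /negPf ->.
  by rewrite mul0r.
rewrite -dE; apply: cvg_lim => //.
have := @conjR_derive x d; apply: cvg_trans; apply: near_eq_cvg;
  apply: nearW => h.
rewrite addr0 /conjR -[RHS]/(_ * _); congr (_ * (_ - fine (conjugate f _))).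
by apply/funext => i; rewrite mul0r addr0.
Qed.

End conjugate_smoothness.

(** * Perspectives *)

Section perspective.
Context {R : realType} {Theta : finType} (f : (Theta -> R) -> \bar R).
Hypothesis f_regular : regular f.
Implicit Types x y z d p : Theta -> R.

(** The perspective of [f], extended to [t = 0] by the recession limit from the point 1; it is the
    summand of [divergence]. *)
Definition perspective p (t : R) : \bar R :=
  if t == 0 then lim ((s^-1)%:E * f (fun th => 1 + s * p th)%R @[s --> +oo%R])%E
  else (t%:E * f (fun th => p th / t)%R)%E.

Lemma perspective00 : perspective (fun=> 0) 0 = 0%E.
Proof.
rewrite /perspective eqxx; apply: cvg_lim => //.
have E : (fun s : R => ((s^-1)%:E * f (fun=> 1 + s * 0)%R)%E) = cst 0%E.
  apply/funext => s /=; rewrite (_ : (fun=> _) = fun=> 1); last first.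
    by apply/funext => i; rewrite mulr0 addr0.
  by rewrite regular1// mule0.
by rewrite E; exact: cvg_cst.
Qed.

Lemma perspective0 p : orthant p -> p <> (fun=> 0) -> perspective p 0 = +oo%E.
Proof.
move=> op p0; rewrite /perspective eqxx; apply: cvg_lim => //.
apply: (regular_superlinear f_regular _ op p0).
by split; [move=> i; exact: ler01|rewrite regular1].
Qed.

Let dot_div p (t : R) x : t != 0 -> t^-1 * (dot p x - t * conjR f x) =
  dot x (fun th => p th / t) - conjR f x.
Proof.
move=> t0; rewrite (_ : (fun th => p th / t) = t^-1 *: p); last first.
  by apply/funext => i; rewrite mulrC.
by rewrite dotZr (dotC x) mulrBr mulKf.
Qed.

(** Fenchel's inequality at [p / t], scaled by [t]; at [t = 0] the perspective is 0 or [+oo]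
    according to whether [p] vanishes. *)
Lemma perspective_ge p (t : R) x : orthant p -> 0 <= t ->
  ((dot p x - t * conjR f x)%:E <= perspective p t)%E.
Proof.
move=> op t0; have [->|tn0] := eqVneq t 0.
  have [->|/eqP p0] := eqVneq p (fun=> 0); last by rewrite perspective0// leey.
  by rewrite perspective00 mul0r subr0 dotC dot0r.
have tp : 0 < t by rewrite lt_neqAle eq_sym tn0.
rewrite /perspective (negPf tn0) -lee_pdivrMl// -EFinM dot_div//.
by apply: fenchel_ineq => // i; rewrite divr_ge0.
Qed.

Lemma perspective_grad (t : R) x : 0 <= t ->
  perspective (t *: grad f x) t =
  (dot (t *: grad f x) x - t * conjR f x)%:E.
Proof.
move=> t0; have [->|tn0] := eqVneq t 0.
  by rewrite scale0r perspective00 mul0r subr0 dotC dot0r.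
rewrite /perspective (negPf tn0).
rewrite (_ : (fun th => _ / t) = grad f x); last first.
  by apply/funext => i; rewrite !fctE /GRing.scale/= mulrC mulKf.
by rewrite f_grad// -EFinM dotZl dotC mulrBr.
Qed.

Lemma perspective_eq p (t : R) x : orthant p -> 0 <= t ->
  (perspective p t <= (dot p x - t * conjR f x)%:E)%E -> p = t *: grad f x.
Proof.
move=> op t0; have [->|tn0] := eqVneq t 0.
  have [-> _|/eqP p0] := eqVneq p (fun=> 0); last by rewrite perspective0.
  by rewrite scale0r.
have tp : 0 < t by rewrite lt_neqAle eq_sym tn0.
rewrite /perspective (negPf tn0) -lee_pdivlMl// -EFinM dot_div//.
have opt : orthant (fun th => p th / t) by move=> i; rewrite divr_ge0.
have [E _|ne] := pselect ((fun th => p th / t) = grad f x).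
  by rewrite -E; apply/funext => i; rewrite fctE /GRing.scale/= mulrC divfK.
by rewrite leNgt fenchel_lt.
Qed.

Lemma perspective_ge0 p (t : R) :
  orthant p -> 0 <= t -> (0 <= perspective p t)%E.
Proof.
move=> op t0; have [->|tn0] := eqVneq t 0.
  have [->|/eqP p0] := eqVneq p (fun=> 0); last by rewrite perspective0.
  by rewrite perspective00.
rewrite /perspective (negPf tn0) mule_ge0 ?lee_fin//.
by apply: regular_ge0 => // i; rewrite divr_ge0.
Qed.

(** For [t > 0] semicontinuity comes from that of [f] at [p / t]. At [t = 0] with [p] nonzero, the
    values blow up by uniform superlinear growth. *)
Lemma perspective_lsc p (t : R) : orthant p -> 0 <= t ->
  lsc_at (within [set s | 0 <= s] (nbhs t)) (perspective p) (perspective p t).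
Proof.
move=> op t0 r; have [->|tn0] := eqVneq t 0.
  have [->|/eqP p0] := eqVneq p (fun=> 0).
    rewrite perspective00 => r0; rewrite near_withinE; apply: nearW => s s0.
    by rewrite (lt_le_trans r0)// perspective_ge0.
  move=> _; set S := \sum_th p th.
  have S0 : 0 < S.
    rewrite lt_neqAle sumr_ge0// andbT eq_sym; apply/eqP => S0.
    apply: p0; apply/funext => i; apply/eqP.
    by move: S0 => /eqP; rewrite psumr_eq0// => /allP/(_ i (mem_index_enum i)).
  have [M M0 MC] := superlinear_growth f_regular (r / S).
  (* For [0 < s < S / M] the mass [S / s] of [p / s] exceeds [M], and slope [r / S] scaled by [s]
     yields exactly [r]. *)
  rewrite near_withinE; exists (S / M) => /=; first by rewrite divr_gt0.
  move=> s; rewrite /= sub0r normrN => sM s0.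
  have [->|sn0] := eqVneq s 0; first by rewrite perspective0// ltry.
  have sp : 0 < s by rewrite lt_neqAle eq_sym sn0.
  rewrite gtr0_norm// ltr_pdivlMr// in sM.
  rewrite /perspective (negPf sn0).
  have osp : orthant (fun th => p th / s) by move=> i; rewrite divr_ge0.
  have sS : \sum_th p th / s = S / s by rewrite -mulr_suml.
  have := MC _ osp; rewrite sS ltr_pdivlMr// mulrC => /(_ sM).
  rewrite -(@lte_pmul2l _ s%:E)// -EFinM; apply: le_lt_trans.
  rewrite lee_fin (_ : s * (r / S * (S / s)) = r)//.
  by field; rewrite sn0 gt_eqF.
have tp : 0 < t by rewrite lt_neqAle eq_sym tn0.
rewrite {1}/perspective (negPf tn0) -lte_pdivrMl// -EFinM.
move=> /lte_between[c /andP[rc cf]]; rewrite lte_fin in rc.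
have cvgp : (fun th => p th / s) @[s --> t] -->
    ((fun th => p th / t) : {ptws Theta -> R}).
  apply: (@cvg_coord _ _ _ (nbhs t) _ (fun s th => p th / s)) => i.
  by apply: cvgM; [exact: cvg_cst|apply: cvgV => //; exact: cvg_id].
have opt : orthant (fun th => p th / t) by move=> i; rewrite divr_ge0.
have fc : \forall s \near t, orthant (fun th => p th / s) ->
    (c%:E < f (fun th => p th / s)%R)%E.
  exact: (cvgp _ (lsc_fun_near f_regular opt cf)).
have sc : \forall s \near t, r < s * c.
  have h : s * c @[s --> t] --> t * c by apply: cvgM;
    [exact: cvg_id|exact: cvg_cst].
  by move/cvgr_gt : h; apply; rewrite -ltr_pdivrMl.
have sp : \forall s \near t, 0 < s by exact: lt_nbhsr.
rewrite near_withinE; apply: filterS3 fc sc sp => s fc sc sp _.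
rewrite /perspective gt_eqF//.
have /fc : orthant (fun th => p th / s) by move=> i; rewrite divr_ge0// ltW.
rewrite -(@lte_pmul2l _ s%:E)// -EFinM; apply: lt_trans.
by rewrite lte_fin.
Qed.

End perspective.

(** * Convex and linear alternatives *)

(** Take the point [d] of least norm in the convex hull of the [w a]. If it is nonzero, moving
    towards [w a] cannot shorten it, so [dot d (w a) >= dot d d > 0]. *)
Lemma gordan (R : realType) (A I : finType) (w : A -> I -> R) (a0 : A) :
  (exists2 alpha, simplex A alpha & forall i, \sum_a alpha a * w a i = 0) \/
  (exists d : I -> R, forall a, 0 < dot d (w a)).
Proof.
pose z (alpha : A -> R) i := \sum_a alpha a * w a i.
pose q (alpha : {ptws A -> R}) : \bar R := (dot (z alpha) (z alpha))%:E.
have Sa (a : A) : simplex A (fun b => (b == a)%:R : R).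
  split; first by move=> b; rewrite ler0n.
  by rewrite (bigD1 a)//= eqxx big1 ?addr0// => b /negPf ->.
have [alpha [Salpha qmin]] : exists alpha, is_argmin (simplex A) q alpha.
  apply: (@compact_lsc_argmin R {ptws A -> R} (simplex A) q (@compact_simplex _
    _)).
    by exists (fun b => (b == a0)%:R); exact: Sa.
  move=> x _; apply: lsc_at_cvg; apply: cvg_within_filter.
  have zc i : z (y : A -> R) i @[y --> x] --> z x i.
    by apply: cvg_sumr => a; apply: cvgM; [exact: cvg_eval|exact: cvg_cst].
  exact: (@cvg_dot _ _ _ _ _ (fun y => z y) (fun y => z y) _ _ zc zc).
have [z0|/existsNP[i zi]] := pselect (forall i, z alpha i = 0).
  by left; exists alpha.
right; exists (z alpha) => a; set d := z alpha in zi *.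
have [e eE] : exists e, e = w a - d by exists (w a - d).
have dd : 0 < dot d d.
  rewrite lt_neqAle eq_sym psumr_neq0; last by move=> j _;
    rewrite -expr2 sqr_ge0.
  rewrite sumr_ge0 ?andbT; last by move=> j _; rewrite -expr2 sqr_ge0.
  apply/hasP; exists i; first exact: mem_index_enum.
  by rewrite -expr2 /= exprn_even_gt0//=; exact/eqP.
have ee : 0 <= dot e e by apply: sumr_ge0 => j _; rewrite -expr2 sqr_ge0.
have qs (s : R) : 0 <= s <= 1 -> 0 <= 2 * s * dot d e + s ^+ 2 * dot e e.
  move=> s01; pose beta b := (1 - s) * alpha b + s * (b == a)%:R.
  have Sb : simplex A beta.
    have [al0 al1] := Salpha; have [b0 b1] := Sa a; split.
      by move=> b; rewrite addr_ge0// mulr_ge0//; lra.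
    by rewrite big_split/= -!mulr_sumr al1 b1; ring.
  have zb : z beta = d + s *: e.
    apply/funext => j; rewrite eE !fctE /GRing.scale/= /z.
    under eq_bigr do rewrite mulrDl -!mulrA.
    rewrite big_split/= -!mulr_sumr -/(z alpha j) -/d.
    rewrite (bigD1 a)//= eqxx mul1r big1 ?addr0; last first.
      by move=> b /negPf ->; rewrite mul0r.
    ring.
  have := qmin _ Sb; rewrite /q zb -/d lee_fin.
  rewrite dotDl !dotDr !dotZl !dotZr (dotC e d) -subr_ge0.
  by congr (0 <= _); ring.
(* If [D < 0], the step [s = - D / (E - D)] gives [2 * D + s * E = D * (1 + s) < 0], contradicting
   minimality. *)
have de : 0 <= dot d e.
  rewrite leNgt; apply/negP; move: (dot d e) (dot e e) ee qs => D E ee qs D0.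
  have ED : 0 < E - D by lra.
  have s01 : 0 <= - D / (E - D) <= 1.
    by apply/andP; split; [apply: divr_ge0; lra|rewrite ler_pdivrMr//; lra].
  have := qs _ s01; set s := - D / (E - D); have sD : s * (E - D) = - D by
    rewrite divfK// gt_eqF.
  have s0 : 0 < s by apply: divr_gt0; lra.
  have -> : 2 * s * D + s ^+ 2 * E = s * (2 * D + s * E) by ring.
  rewrite pmulr_rge0//; nra.
have : dot d e = dot d (w a) - dot d d by rewrite eE dotBr.
by move: de dd; lra.
Qed.

(** A largest independent family drawn from [S]: a vector of [S] outside its span could be appended
    to it. *)
Lemma row_free_spanning (F : fieldType) (n : nat) (S : set 'rV[F]_n) :
  exists k (B : 'M[F]_(k, n)), [/\ row_free B, (forall i, S (row i B)) &
    forall v, S v -> (v <= B)%MS].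
Proof.
pose P k := `[< exists B : 'M[F]_(k, n), row_free B /\ forall i, S (row i B) >].
have P0 : exists k, P k.
  exists 0%N; apply/asboolP; exists 0; split; last by case.
  by rewrite /row_free mxrank0.
have Pn k : P k -> (k <= n)%N.
  by move=> /asboolP[B [/eqP Bk _]]; rewrite -{1}Bk rank_leq_col.
have [k /asboolP[B [fB SB]] kmax] := ex_maxnP P0 Pn.
exists k, B; split=> // v Sv; apply: contrapT => /negP vB.
suff : P k.+1 by move=> /kmax; rewrite ltnn.
apply/asboolP; exists (col_mx v B : 'M[F]_(1 + k, n)); split.
  have BvB : (B < col_mx v B)%MS.
    rewrite /ltmx -addsmxE addsmxSr /= -addsmxE addsmx_sub (negPf vB).
    by [].
  have := rank_ltmx BvB; rewrite (eqP fB) => kr.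
  by rewrite /row_free eqn_leq rank_leq_row.
move=> i; case: (splitP (i : 'I_(1 + k))) => j ij.
  have -> : i = lshift k j by apply/val_inj.
  by rewrite -[row _ _]/(row (lshift k j) _) rowKu row_id.
have -> : i = rshift 1 j by apply/val_inj.
by rewrite -[row _ _]/(row (rshift 1 j) _) rowKd.
Qed.

(** The dual family [c] consists of the columns of a right inverse of the matrix whose rows are the
    [b i]. *)
Lemma biorthogonal_spanning (R : realType) (I : finType) (S : set (I -> R)) :
  exists k (b c : 'I_k -> I -> R), [/\ forall i, S (b i),
    forall i j, dot (b i) (c j) = (i == j)%:R &
    forall v, S v -> exists D : 'I_k -> R, v = fun th => \sum_i D i * b i th].
Proof.
have [k [B [/row_freeP[C BC] SB Bv]]] :=
  @row_free_spanning R #|I| [set u | S (fun th => u 0 (enum_rank th))].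
exists k, (fun i th => B i (enum_rank th)), (fun j th => C (enum_rank th) j).
split.
- by move=> i; have := SB i; congr (S _); apply/funext => th; rewrite mxE.
- move=> i j; have := congr1 (fun M : 'M[R]_k => M i j) BC; rewrite !mxE => <-.
  by rewrite (reindex (@enum_rank I))//; exact/onW_bij/enum_rank_bij.
- move=> v Sv; have : (\row_l v (enum_val l) <= B)%MS.
    apply: Bv; rewrite /=; move: Sv; congr (S _); apply/funext => th.
    by rewrite mxE enum_rankK.
  move=> /submxP[D DE]; exists (fun i => D 0 i); apply/funext => th.
  have := congr1 (fun M : 'rV[R]_#|I| => M 0 (enum_rank th)) DE.
  by rewrite !mxE enum_rankK.
Qed.

(** By invariance [h] depends only on the finitely many coordinates [dot x (b i)], and in these its
    sublevel sets are bounded, so a minimum over a box is global. *)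
Lemma argmin_modulo_orthogonal (R : realType) (I : finType)
    (S : set (I -> R)) (h : (I -> R) -> R) :
  (forall x, lsc_at (nbhs (x : {ptws I -> R})) (fun y => (h y)%:E) (h x)%:E) ->
  (forall x d, (forall v, S v -> dot d v = 0) -> h (x + d) = h x) ->
  (forall v, S v ->
    forall r, exists B, forall x, h x <= r -> `|dot x v| <= B) ->
  exists x, forall y, h x <= h y.
Proof.
move=> hlsc hinv hcoer; have [k [b [c [Sb bc Sspan]]]] := biorthogonal_spanning
  S.
(* A linear section: it rebuilds a vector with prescribed coordinates [t]. *)
pose Phi (t : 'I_k -> R) : I -> R := fun th => \sum_i t i * c i th.
have Phib t j : dot (Phi t) (b j) = t j.
  have -> : dot (Phi t) (b j) = \sum_i t i * dot (b j) (c i).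
    rewrite /dot /Phi; under eq_bigr do rewrite mulr_suml.
    rewrite exchange_big/=; apply: eq_bigr => i _; rewrite mulr_sumr.
    by apply: eq_bigr => th _; ring.
  rewrite (bigD1 j)//= bc eqxx mulr1 big1 ?addr0// => i /negPf ij.
  by rewrite bc eq_sym ij mulr0.
have hPhi x : h x = h (Phi (fun i => dot x (b i))).
  rewrite -[in RHS](subrKC x (Phi _)) hinv// => v /Sspan[D ->].
  rewrite /dot; under eq_bigr do rewrite mulr_sumr.
  rewrite exchange_big/= big1// => i _.
  under eq_bigr do rewrite mulrCA.
  by rewrite -mulr_sumr -/(dot _ (b i)) dotBl Phib subrr mulr0.
have /choice[B hB] : forall i,
    exists B, forall x, h x <= h 0 -> `|dot x (b i)| <= B.
  by move=> i; exact: hcoer.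
(* The box contains the coordinates of every point at level at most [h 0], and also the origin,
   which beats all other points. *)
pose M := \sum_i `|B i|.
pose K := [set t : {ptws 'I_k -> R} | forall i, `[- M, M]%classic (t i)].
have M0 : 0 <= M by exact: sumr_ge0.
have K0 : K (fun=> 0) by move=> i /=; rewrite in_itv/= oppr_le0 M0.
have [t [Kt tmin]] : exists t, is_argmin K (fun t => (h (Phi t))%:E) t.
  apply: (@compact_lsc_argmin R {ptws 'I_k -> R} K _ (@compact_box _ _ _ _)).
    by exists (fun=> 0).
  move=> t _ r rt; apply: cvg_within.
  have Phic : Phi (s : 'I_k -> R) @[s --> t] --> (Phi t : {ptws I -> R}).
    apply: (@cvg_coord _ _ _ (nbhs t) _ Phi) => th; apply: cvg_sumr => i.
    by apply: cvgM; [exact: cvg_eval|exact: cvg_cst].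
  exact: (Phic _ (hlsc _ _ rt)).
exists (Phi t) => x.
have Phi0 : Phi (fun=> 0) = 0.
  by apply/funext => th; rewrite /Phi big1// => i _; rewrite mul0r.
have [xh|/ltW hx] := leP (h x) (h 0); last first.
  by apply: le_trans hx; rewrite -Phi0 -lee_fin; exact: tmin.
rewrite (hPhi x) -lee_fin; apply: tmin => i /=.
rewrite in_itv/= -ler_norml (le_trans (hB i x xh))// /M (bigD1 i)//=.
by rewrite (le_trans (ler_norm _))// lerDl sumr_ge0.
Qed.

(** * Saddle points of the Lagrangian *)

Section saddle.
Context {R : realType} {Theta A : finType} (f : (Theta -> R) -> \bar R).
Variable u : A -> Theta -> R.
Hypothesis f_regular : regular f.
Hypothesis f_nondeg : nondegenerate_domain f.
Implicit Types (x y z d l : Theta -> R) (al : A -> R).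

Definition lagrangian al l : R :=
  \sum_a al a * conjR f (u a - l) + \sum_th l th.

Let g (a : A) l : R := conjR f (u a - l) + \sum_th l th.

(** The domain recentred at the point 1; directions orthogonal to it leave every [g a] unchanged. *)
Let S : set (Theta -> R) := [set v | dom f ((fun=> 1) + v)].

Lemma lagrangianE al l : simplex A al ->
  lagrangian al l = \sum_a al a * g a l.
Proof.
move=> [_ al1]; rewrite /g; under eq_bigr do rewrite mulrDr.
by rewrite big_split/= -mulr_suml al1 mul1r.
Qed.

Lemma dom_retract v : S v -> exists2 e : R, 0 < e & S ((- e) *: v).
Proof.
move=> Sv; have [_ dn] := f_nondeg.
have cv : (fun=> 1) + t *: v @[t --> (0 : R)] -->
    ((fun=> 1) : {ptws Theta -> R}).
  apply: (@cvg_coord _ _ _ (nbhs (0 : R)) _ (fun t => (fun=> 1) + t *: v)) => i.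
  have h : 1 + t * v i @[t --> (0 : R)] --> 1 + 0 * v i.
    apply: cvgD; first exact: cvg_cst.
    by apply: cvgM; [exact: cvg_id|exact: cvg_cst].
  by rewrite mul0r addr0 in h; exact: h.
have : \forall t \near (0 : R), affine_hull (dom f) ((fun=> 1) + t *: v) ->
    dom f ((fun=> 1) + t *: v) by exact: (cv _ dn).
move=> [e /= e0 eP]; exists (e / 2); first by rewrite divr_gt0.
apply: eP; first by rewrite /= sub0r opprK gtr0_norm ?divr_gt0//; lra.
(* The weights [1 - t] and [t] on the points 1 and [1 + v] place [1 + t v] in the affine hull,
   although [t] is negative. *)
pose t := - (e / 2); exists 2%N.
exists (fun i : 'I_2 => if i == ord0 then 1 - t else t).
exists (fun i : 'I_2 => if i == ord0 then (fun=> 1) else (fun=> 1) + v).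
split.
- move=> i; case: ifP => // _.
  by split; [move=> j; exact: ler01|rewrite regular1].
- by rewrite big_ord_recl big_ord1/=; ring.
- rewrite big_ord_recl big_ord1/=; apply/funext => i.
  by rewrite /t !fctE /GRing.scale/=; ring.
Qed.

(** Fenchel's inequality at [1 + v]: the point 1 absorbs the sum of [l], leaving an affine minorant
    of slope [- v]. *)
Lemma g_ge v : S v -> exists C : R, forall a l, - dot l v - C <= g a l.
Proof.
move=> [oy yfin]; set y := (fun=> 1) + v in oy yfin.
exists (\sum_a `|dot (u a) y - fine (f y)|) => a l.
have := fenchel_ineq f_regular (u a - l) oy.
rewrite -[f y]fineK; last first.
  by rewrite ge0_fin_numE// regular_ge0.
rewrite lee_fin dotBl => fy.
have : `|dot (u a) y - fine (f y)| <= \sum_a `|dot (u a) y - fine (f y)|.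
  by rewrite (bigD1 a)//= lerDl sumr_ge0.
have := ler_norm (- (dot (u a) y - fine (f y))); rewrite normrN.
have -> : dot l v = dot l y - \sum_th l th.
  by rewrite /y dotDr dot1r; ring.
by rewrite /g; move: fy; lra.
Qed.

Lemma g_orthogonal a l d :
  (forall v, S v -> dot d v = 0) -> g a (l + d) = g a l.
Proof.
move=> dS; rewrite /g opprD addrA (@conjR_orthogonal _ _ _ f_regular (u a - l)
  (- d)).
  by rewrite -addrA -big_split/=; congr (_ + _); apply: eq_bigr => i _;
    rewrite !fctE; ring.
move=> y dy; have : dot d (y - (fun=> 1)) = 0.
  by apply: dS; rewrite /S /= subrKC.
by rewrite dotBr dot1r => /eqP; rewrite subr_eq0 dotNl => /eqP ->;
  rewrite -sumrN.
Qed.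

Lemma g_lsc a l : lsc_at (nbhs (l : {ptws Theta -> R}))
  (fun k => (g a k)%:E) (g a l)%:E.
Proof.
have cu : u a - k @[k --> (l : {ptws Theta -> R})] -->
    (u a - l : {ptws Theta -> R}).
  apply: (@cvg_coord _ _ _ (nbhs (l : {ptws Theta -> R})) _ (fun k => u a - k))
    => i.
  by apply: cvgB; [exact: cvg_cst|exact: cvg_eval].
have h1 : lsc_at (nbhs (l : {ptws Theta -> R}))
    (fun k => (conjR f (u a - k))%:E) (conjR f (u a - l))%:E.
  by move=> r rl; exact: (cu _ (conjR_lsc f_regular rl)).
have h2 : lsc_at (nbhs (l : {ptws Theta -> R}))
    (fun k => (\sum_th k th)%:E) (\sum_th l th)%:E.
  by apply: lsc_at_cvg; apply: cvg_sumr => i; exact: cvg_eval.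
by rewrite /g EFinD; exact: (lsc_atD h1 h2).
Qed.

(* Applied both to the maximum of the [g a] and to their averages. *)
Lemma argmin_aggregate (h : (Theta -> R) -> R) :
  (forall l, lsc_at (nbhs (l : {ptws Theta -> R}))
    (fun k => (h k)%:E) (h l)%:E) ->
  (forall k l, (forall a, g a k = g a l) -> h k = h l) ->
  (forall l b, (forall a, b <= g a l) -> b <= h l) ->
  exists l, forall k, h l <= h k.
Proof.
move=> hlsc hg hge; apply: (argmin_modulo_orthogonal (S := S)) => //.
  by move=> l d dS; apply: hg => a; exact: g_orthogonal.
(* The minorant for [v] bounds [dot l v] from below on a sublevel set, the one for [- e v] from
   above. *)
move=> v Sv r; have [e e0 Sev] := dom_retract Sv.
have [C1 hC1] := g_ge Sv; have [C2 hC2] := g_ge Sev.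
exists (`|r + C1| + `|r + C2| / e) => l hr.
have := le_trans (hge _ _ (hC1 ^~ l)) hr.
have := le_trans (hge _ _ (hC2 ^~ l)) hr.
rewrite dotZr => h2 h1; rewrite ler_norml; apply/andP; split.
  have : 0 <= `|r + C2| / e by rewrite divr_ge0// ltW.
  by have := ler_norm (r + C1); move: h1; lra.
have := ler_norm (r + C2); have : 0 <= `|r + C1| by [].
have : dot l v <= `|r + C2| / e -> 0 <= `|r + C1| ->
  dot l v <= `|r + C1| + `|r + C2| / e by lra.
move=> + c1 c2; apply => //; rewrite ler_pdivlMr//; move: h2 c2; lra.
Qed.

(** This makes the inner minimum of (MM) attained at every [al], not only at the saddle point. *)
Lemma lagrangian_argmin al : simplex A al ->
  exists l, forall k, lagrangian al l <= lagrangian al k.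
Proof.
move=> Sal; have [al0 al1] := Sal.
have [l lmin] : exists l, forall k, \sum_a al a * g a l <= \sum_a al a * g a k.
  apply: argmin_aggregate.
  - move=> l; rewrite -sumEFin.
    have -> : (fun k : {ptws Theta -> R} => (\sum_a al a * g a k)%:E) =
        (fun k => \sum_a (al a * g a k)%:E)%E.
      by apply/funext => k; rewrite sumEFin.
    by apply: lsc_at_sum => a; apply: lsc_atZ => //; exact: g_lsc.
  - by move=> k l kl; apply: eq_bigr => a _; rewrite kl.
  - move=> l b bg; rewrite -[b]mul1r -al1 mulr_suml.
    by apply: ler_sum => a _; exact: ler_wpM2l.
by exists l => k; rewrite !lagrangianE.
Qed.

(* At a minimizer [l] of the maximum of the [g a], the gradients of the active
   [g a] have a vanishing convex combination, otherwise some direction would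
   decrease all of them. The extra coordinate of the vectors given to [gordan]
   is the slack of [g a], so that inactive constraints need no separate care. *)
Lemma saddle_exists (a0 : A) : exists al l, [/\ simplex A al,
  forall a, g a l <= lagrangian al l &
  forall th, \sum_a al a * grad f (u a - l) th = 1].
Proof.
pose am l := [arg max_(a > a0) g a l]%O.
have amax l a : g a l <= g (am l) l by rewrite /am; case: arg_maxP => // b _;
  apply.
have [l lmin] : exists l, forall k, g (am l) l <= g (am k) k.
  apply: argmin_aggregate.
  - move=> l r /g_lsc; apply: filterS => k; rewrite !lte_fin => /lt_le_trans.
    by apply; exact: amax.
  - move=> k l kl; apply/eqP; rewrite eq_le; apply/andP; split.
      by rewrite kl; exact: amax.
    by rewrite -kl; exact: amax.
  - by move=> l b; exact.
set G := g (am l) l in lmin.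
pose w (a : A) (i : Theta + unit) :=
  if i is inl th then 1 - grad f (u a - l) th else g a l - G.
have [[al Sal alw]|[d dw]] := gordan w a0.
  exists al, l; have [al0 al1] := Sal; split=> //.
    have := alw (inr tt); rewrite /w.
    under eq_bigr do rewrite mulrBr.
    rewrite sumrB -mulr_suml al1 mul1r -lagrangianE// => /eqP.
    by rewrite subr_eq0 => /eqP -> a; exact: amax.
  move=> th; have := alw (inl th); rewrite /w.
  under eq_bigr do rewrite mulrBr mulr1.
  by rewrite sumrB al1 => /eqP; rewrite subr_eq0 eq_sym => /eqP.
exfalso; pose d' th := d (inl th).
have dwE a : dot d (w a) =
    \sum_th d' th - dot d' (grad f (u a - l)) + d (inr tt) * (g a l - G).
  rewrite /dot big_sumType/= (big_pred1 tt); last by case.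
  congr (_ + _).
  by rewrite -sumrB; apply: eq_bigr => th _; rewrite mulrBr mulr1.
(* The change of [g a] is bounded through the gradient at the displaced point, so continuity of the
   gradient along [d'] gives its sign for small [t]. *)
pose rho a (t : R) := dot d' (grad f (u a - l + t *: d')) - \sum_th d' th.
have grho a t : g a (l - t *: d') <= g a l + t * rho a t.
  have := conjR_subgradient f_regular (u a - l + t *: d') (- (t *: d')).
  rewrite addrK dotNl dotZl /g opprB addrA [u a + _ - _]addrAC /rho.
  rewrite [in X in _ -> X]sumrB -mulr_sumr.
  by lra.
have rhoc a : rho a t @[t --> (0 : R)^'+] -->
      dot d' (grad f (u a - l)) - \sum_th d' th.
  apply: cvg_at_right_filter; apply: cvgB; last exact: cvg_cst.
  exact: (@grad_continuous_along _ _ _ f_regular (u a - l) d').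
(* Active [g a] have negative limiting slope, their slack term in [dwE] being zero; inactive ones
   stay below [G] for small [t]. *)
have dec : \forall t \near (0 : R)^'+, forall a, g a (l - t *: d') < G.
  apply: filter_forall => a; have := amax l a; rewrite -/G le_eqVlt.
  move=> /orP[/eqP gG|gG].
    have rho0 : dot d' (grad f (u a - l)) - \sum_th d' th < 0.
      by have := dw a; rewrite dwE gG subrr mulr0 addr0; lra.
    have r0 : \forall t \near (0 : R)^'+, rho a t < 0.
      exact: (@cvgr_lt _ _ _ _ _ _ (rhoc a) _ rho0).
    have t0 : \forall t \near (0 : R)^'+, 0 < t by exact: nbhs_right_gt.
    apply: filterS2 r0 t0 => t r0 t0; apply: le_lt_trans (grho a t) _.
    by rewrite gG gtrDl pmulr_rlt0.
  have h : g a l + t * rho a t @[t --> (0 : R)^'+] -->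
      g a l + 0 * (dot d' (grad f (u a - l)) - \sum_th d' th).
    apply: cvgD; first exact: cvg_cst.
    by apply: cvgM => //; apply: cvg_at_right_filter; exact: cvg_id.
  rewrite mul0r addr0 in h.
  have h' : \forall t \near (0 : R)^'+, g a l + t * rho a t < G.
    exact: (@cvgr_lt _ _ _ _ _ _ h _ gG).
  by apply: filterS h' => t; exact: le_lt_trans.
have [t gt] := filter_ex dec.
by have := lmin (l - t *: d'); rewrite leNgt gt.
Qed.

End saddle.

(** * Duality *)

Section duality.
Context {R : realType} {Theta A : finType} (f : (Theta -> R) -> \bar R).
Variable u : A -> Theta -> R.
Hypothesis f_regular : regular f.
Implicit Types (P : Theta -> A -> R) (al : A -> R) (l : Theta -> R).

(** The expected utility in (RI), grouped by action, with the prior absorbed into [u]. *)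
Definition payoff P : R := \sum_a dot (P^~ a) (u a).

Lemma divergenceE P al :
  divergence f P al = (\sum_a perspective f (P^~ a) (al a))%E.
Proof. by []. Qed.

(** Each [P th] has mass 1, so the sum of [l] spreads over the actions and every summand becomes the
    lower bound of [perspective_ge]. *)
Lemma payoff_lagrangian P al l : kernels Theta A P ->
  payoff P - lagrangian f u al l =
  \sum_a (dot (P^~ a) (u a - l) - al a * conjR f (u a - l)).
Proof.
move=> kP; rewrite sumrB /lagrangian /payoff opprD addrA -addrAC; congr (_ - _).
under [in RHS]eq_bigr do rewrite dotBr.
rewrite sumrB; congr (_ - _); rewrite /dot exchange_big;
  apply: eq_bigr => th _ /=.
by rewrite -mulr_suml; have [_ ->] := kP th; rewrite mul1r.
Qed.

Lemma weak_duality P al l : kernels Theta A P -> (forall a, 0 <= al a) ->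
  ((payoff P - lagrangian f u al l)%:E <= divergence f P al)%E.
Proof.
move=> kP al0; rewrite payoff_lagrangian// divergenceE -sumEFin.
apply: lee_sum => a _; apply: perspective_ge => // th.
by have [P0 _] := kP th.
Qed.

Lemma divergence_tight P al l : kernels Theta A P -> (forall a, 0 <= al a) ->
  (forall th a, P th a = al a * grad f (u a - l) th) ->
  divergence f P al = (payoff P - lagrangian f u al l)%:E.
Proof.
move=> kP al0 PE; rewrite payoff_lagrangian// divergenceE -sumEFin.
apply: eq_bigr => a _.
have -> : P^~ a = al a *: grad f (u a - l) by apply/funext => th; exact: PE.
exact: perspective_grad.
Qed.

(** Every summand obeys [perspective_ge]; cancelling the finite bounds at the other actions reverses
    the inequality at [a], where [perspective_eq] applies. *)
Lemma tight_grad P al l : kernels Theta A P -> (forall a, 0 <= al a) ->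
  (divergence f P al <= (payoff P - lagrangian f u al l)%:E)%E ->
  forall th a, P th a = al a * grad f (u a - l) th.
Proof.
move=> kP al0; rewrite payoff_lagrangian// divergenceE => tight th a.
have oP b : orthant (P^~ b) by move=> i; have [] := kP i.
suff h : (perspective f (P^~ a) (al a) <=
    (dot (P^~ a) (u a - l) - al a * conjR f (u a - l))%:E)%E.
  exact: (congr1 (@^~ th) (perspective_eq f_regular (oP a) (al0 a) h)).
rewrite (bigD1 a)//= [in leRHS](bigD1 a)//= EFinD in tight.
rewrite -(@leeD2rE _ (\sum_(i | i != a)
  (dot (P^~ i) (u i - l) - al i * conjR f (u i - l)))%:E)//.
apply: le_trans tight; apply: leeD2l; rewrite -sumEFin.
by apply: lee_sum => b _; exact: perspective_ge.
Qed.

Lemma f_mean_exists P (a0 : A) : kernels Theta A P -> exists al, f_mean f P al.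
Proof.
move=> kP; have oP b : orthant (P^~ b) by move=> i; have [] := kP i.
apply: (@compact_lsc_argmin R {ptws A -> R} (simplex A) (divergence f P)
  (@compact_simplex _ _)).
  exists (fun b => (b == a0)%:R); split; first by move=> b; rewrite ler0n.
  by rewrite (bigD1 a0)//= eqxx big1 ?addr0// => b /negPf ->.
move=> al [al0 _]; rewrite divergenceE; apply: lsc_at_sum => a r ra.
have h := perspective_lsc f_regular (oP a) (al0 a) ra.
have h' : \forall be \near (al : {ptws A -> R}), 0 <= be a ->
  (r%:E < perspective f (P^~ a) (be a))%E by exact: (@cvg_eval _ _ al a _ h).
rewrite near_withinE; apply: filterS h' => be h' [be0 _].
exact: h'.
Qed.

Lemma f_informationE P al : f_mean f P al ->
  f_information f P = divergence f P al.
Proof.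
move=> [Sal amin]; apply/eqP; rewrite eq_le; apply/andP; split.
  by apply: ereal_inf_lbound; exists al.
by apply: le_ereal_inf_tmp => _ [be Sbe <-]; exact: amin.
Qed.

(** Weak duality bounds every divergence below by [payoff P] minus the Lagrangian at [be]; since
    [al] maximizes the Lagrangian and is tight, none is smaller. *)
Lemma saddle_f_mean P al l : kernels Theta A P -> simplex A al ->
  (forall be, simplex A be -> lagrangian f u be l <= lagrangian f u al l) ->
  (forall th a, P th a = al a * grad f (u a - l) th) -> f_mean f P al.
Proof.
move=> kP Sal smax PE; split=> // be Sbe.
rewrite (divergence_tight kP Sal.1 PE).
apply: le_trans (weak_duality l kP Sbe.1).
by rewrite lee_fin lerB// smax.
Qed.

Lemma information_value_le P l (v : R) : kernels Theta A P ->
  (forall be, simplex A be -> lagrangian f u be l <= v) ->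
  ((payoff P)%:E - f_information f P <= v%:E)%E.
Proof.
move=> kP vmax; have : ((payoff P - v)%:E <= f_information f P)%E.
  apply: le_ereal_inf_tmp => _ [be Sbe <-].
  apply: le_trans (weak_duality l kP Sbe.1).
  by rewrite lee_fin lerB// vmax.
case: (f_information f P) => [i||]//=; last by rewrite addeNy leNye.
by rewrite -EFinB !lee_fin; lra.
Qed.

Lemma information_value P al l : kernels Theta A P -> simplex A al ->
  (forall be, simplex A be -> lagrangian f u be l <= lagrangian f u al l) ->
  (forall th a, P th a = al a * grad f (u a - l) th) ->
  ((payoff P)%:E - f_information f P = (lagrangian f u al l)%:E)%E.
Proof.
move=> kP Sal smax PE; rewrite (f_informationE (saddle_f_mean kP Sal smax PE)).
by rewrite (divergence_tight kP Sal.1 PE) -EFinB; congr (_%:E); ring.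
Qed.

End duality.

(** * Both problems solved from one reference saddle point *)

Theorem theorem2 (R : realType) (Theta : finType) (pi : Theta -> R)
    (A : {fset (Theta -> R)}) (f : (Theta -> R) -> \bar R) :
  simplex Theta pi -> (forall th, 0 < pi th) ->
  A != fset0 ->
  (forall x, orthant x -> (0 <= f x)%E) ->
  convex_fun f -> lsc_fun f -> f (fun=> 1) = 0%E ->
  superlinear_at_infinity f ->
  essentially_strictly_convex f ->
  nondegenerate_domain f ->
  [/\ (forall P : Theta -> A -> R, kernels Theta A P ->
        (is_argmax (kernels Theta A) (RI_objective f pi (A := A)) P <->
         exists (alpha : A -> R) (lambda : Theta -> R),
           saddle_point (simplex A) setT (MM_objective f pi (A := A))
             alpha lambda /\
           forall th (a : A), P th a = alpha a *
             partial th (conjugate f)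
               (fun th' => val a th' * pi th' - lambda th'))),
      (forall (P : Theta -> A -> R) (alpha : A -> R) (lambda : Theta -> R),
        kernels Theta A P ->
        saddle_point (simplex A) setT (MM_objective f pi (A := A))
          alpha lambda ->
        (forall th (a : A), P th a = alpha a *
           partial th (conjugate f)
             (fun th' => val a th' * pi th' - lambda th')) ->
        f_mean f P alpha)
    & exists v : \bar R,
        is_max (kernels Theta A) (RI_objective f pi (A := A)) v /\
        is_maxmin (simplex A) setT (MM_objective f pi (A := A)) v].
Proof.
move=> _ _ /fset0Pn[a0 Aa0] f0 fc fl f1 fs fstr fnd.
have freg : regular f by split.
pose u (a : A) : Theta -> R := fun th => val a th * pi th.
have RIE P : RI_objective f pi P = ((payoff u P)%:E - f_information f P)%E.
  rewrite /RI_objective; congr (_%:E - _)%E; rewrite /payoff /dot exchange_big.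
  apply: eq_bigr => th _; rewrite mulr_sumr; apply: eq_bigr => a _.
  by rewrite /u /=; ring.
have MME al l : MM_objective f pi (A := A) al l = (lagrangian f u al l)%:E.
  rewrite /MM_objective /lagrangian EFinD; congr (_ + _)%E.
  by rewrite -sumEFin; apply: eq_bigr => a _; rewrite (conjRE freg) -EFinM.
have partE th (a : A) l : partial th (conjugate f)
    (fun th' => val a th' * pi th' - l th') = grad f (u a - l) th.
  by rewrite partial_conjugate.
have [al [l [Sal gmax grad1]]] := saddle_exists u freg fnd [` Aa0]%fset.
pose P0 th (a : A) := al a * grad f (u a - l) th.
have kP0 : kernels Theta A P0.
  move=> th; split; last exact: grad1.
  by move=> a; rewrite mulr_ge0//; [exact: Sal.1|exact: grad_orthant].
have smax be : simplex A be -> lagrangian f u be l <= lagrangian f u al l.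
  move=> Sbe; rewrite (lagrangianE f u l Sbe) -[leRHS]mul1r -Sbe.2 mulr_suml.
  by apply: ler_sum => a _; apply: ler_wpM2l; [exact: Sbe.1|exact: gmax].
set v := lagrangian f u al l in smax.
have vP0 : RI_objective f pi P0 = v%:E.
  by rewrite RIE; exact: (information_value freg kP0 Sal smax).
have RIv P : kernels Theta A P -> (RI_objective f pi P <= v%:E)%E.
  by move=> kP; rewrite RIE; exact: (information_value_le freg kP smax).
(* Weak duality for [P0] at [k], compared with equality at [l], makes [l] a minimizer against
   [al]. *)
have vmin k : v <= lagrangian f u al k.
  have := weak_duality u freg k kP0 Sal.1.
  rewrite (@divergence_tight _ _ _ f u freg P0 al l kP0 Sal.1)// lee_fin -/v;
    lra.
have saddleE be k :
    saddle_point (simplex A) setT (MM_objective f pi (A := A)) be k ->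
    simplex A be /\ forall ga, simplex A ga ->
      lagrangian f u ga k <= lagrangian f u be k.
  by move=> [Sbe _ h _]; split=> // ga /h; rewrite !MME lee_fin.
split.
- move=> P kP; split; last first.
    move=> [be [k [/saddleE[Sbe bmax] PE]]]; split=> // Q kQ.
    have PE' th a : P th a = be a * grad f (u a - k) th by rewrite PE partE.
    rewrite !RIE (information_value freg kP Sbe bmax PE').
    exact: (information_value_le freg kQ bmax).
  move=> [_ Pmax]; have [be mbe] := f_mean_exists freg [` Aa0]%fset kP.
  have [Sbe _] := mbe.
  (* An optimal [P] does at least as well as [P0], and its information cost is attained at the
     [f]-mean [be]. *)
  have Dle : (divergence f P be <= (payoff u P - v)%:E)%E.
    have := Pmax _ kP0; rewrite vP0 RIE (f_informationE mbe).
    have := weak_duality u freg l kP Sbe.1.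
    case: (divergence f P be) => [i||]//= _.
    by rewrite -EFinB !lee_fin; lra.
  have vk k : v <= lagrangian f u be k.
    have := le_trans (weak_duality u freg k kP Sbe.1) Dle.
    by rewrite lee_fin; lra.
  (* The [f]-mean of [P] pairs with the reference multiplier [l]: [v] is at most the Lagrangian at
     [be] for every [k], and at least its value at [l]. *)
  exists be, l; split; last first.
    move=> th a; rewrite partE; apply: (tight_grad freg kP Sbe.1).
    apply: le_trans Dle _; rewrite lee_fin lerB// smax//.
  split=> //.
    move=> ga Sga; rewrite !MME lee_fin; apply: le_trans (smax _ Sga) _.
    exact: vk.
  by move=> k _; rewrite !MME lee_fin; apply: le_trans (smax _ Sbe) (vk k).
- move=> P be k kP /saddleE[Sbe bmax] PE.
  apply: (saddle_f_mean freg kP Sbe bmax) => th a; by rewrite PE partE.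
- exists v%:E; split.
    by exists P0 => //; split=> // Q kQ; rewrite vP0; exact: RIv.
  pose m (be : A -> R) : \bar R :=
    ereal_inf [set (lagrangian f u be k)%:E | k in setT].
  have mE be k : (forall k', lagrangian f u be k <= lagrangian f u be k') ->
      m be = (lagrangian f u be k)%:E.
    move=> kmin; apply/eqP; rewrite eq_le; apply/andP; split.
      by apply: ereal_inf_lbound; exists k.
    by apply: le_ereal_inf_tmp => _ [k' _ <-]; rewrite lee_fin.
  exists m.
    move=> be Sbe; have [k kmin] := lagrangian_argmin u freg fnd Sbe.
    exists k; last by rewrite MME -(mE be k).
    by split=> // k' _; rewrite !MME lee_fin.
  have mal : m al = v%:E by exact: mE.
  exists al => //; split=> // be Sbe; rewrite mal.
  apply: (@le_trans _ _ (lagrangian f u be l)%:E); last by rewrite lee_fin smax.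
  by apply: ereal_inf_lbound; exists l.
Qed.
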